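(* Let $(T,X)$ be a semiflow on a compact Hausdorff space $X$ with phase semigroup $T$ (a topological semigroup with identity, not necessarily discrete). Then the following statements are pairwise equivalent: (1) $(T,X)$ is an almost periodic semiflow. (2) $(T,X)$ is equicontinuous and surjective. (3) $E(T,X)$ is a group of homeomorphisms of $X$. (4) For every $\alpha\in\mathscr U_X$ there is a bilaterally discretely syndetic subset $A$ of $T$ such that $Ax\subseteq\alpha[x]$ for all $x\in X$. (5) $(T,X)$ is discretely almost periodic. If $T$ is a group, then each of (1)–(5) is equivalent to: (6) For every $\alpha\in\mathscr U_X$ there is a symmetric (i.e. $A=A^{-1}$) discretely syndetic subset $A$ of $T$ such that $Ax\subseteq\alpha[x]$ for all $x\in X$.
   Context: $X$ is a nonempty compact Hausdorff space with compatible uniformity $\mathscr U_X$ (symmetric entourages), $\alpha[x]=\{y:(x,y)\in\alpha\}$. A topological semigroup $T$ is a Hausdorff space with jointly continuous associative multiplication and identity $e$. A semiflow $(T,X)$ is a jointly continuous map $T\times X\to X$, $(t,x)\mapsto tx$, with $ex=x$ and $t(sx)=(ts)x$. It is surjective if $tX=X$ for all $t\in T$; equicontinuous if for every $\varepsilon\in\mathscr U_X$ there is $\delta\in\mathscr U_X$ with $(tx,ty)\in\varepsilon$ for all $t\in T$ whenever $(x,y)\in\delta$. $E(T,X)$, the Ellis semigroup, is the closure of $\{x\mapsto tx: t\in T\}$ in $X^X$ in the topology of pointwise convergence, a semigroup under composition. $A\subseteq T$ is right-syndetic if there is a compact $K\subseteq T$ with $Kt\cap A\neq\emptyset$ for all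 $t\in T$; bilaterally syndetic if there are compact $K_R,K_L\subseteq T$ with $K_Rt\cap A\ne\emptyset$ and $tK_L\cap A\neq\emptyset$ for all $t\in T$. ''Discretely'' means with respect to the discrete topology on $T$, i.e. with the compact sets replaced by finite sets; ''discretely syndetic'' in (6) means discretely right-syndetic (for symmetric subsets of a group this is the same as discretely left-syndetic). $(T,X)$ is almost periodic if for every $\varepsilon\in\mathscr U_X$ there is a right-syndetic set $A\subseteq T$ with $Ax\subseteq\varepsilon[x]$ for all $x\in X$; discretely almost periodic if the same holds with $A$ discretely right-syndetic. *)

(* Defs.v *)
From HB Require Import structures.
From mathcomp Require Import all_boot.
From mathcomp Require Import all_classical.
From mathcomp Require Import topology.

Set Implicit Arguments.
Unset Strict Implicit.
Unset Printing Implicit Defensive.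

Local Open Scope group_scope.
Local Open Scope classical_set_scope.
Local Open Scope relation_scope.

HB.structure Definition PreTopologicalMonoid :=
  {T of Topological T & Monoid T}.

HB.mixin Record PreTopologicalMonoid_isTopologicalMonoid T
    of PreTopologicalMonoid T := {
  mulg_continuous : continuous (fun p : T * T => p.1 * p.2)
}.

(* A topological semigroup with identity; the Hausdorff axiom is not part of
   the structure and is to be assumed separately, as elsewhere in the
   library. *)
#[short(type="topologicalMonoidType")]
HB.structure Definition TopologicalMonoid :=
  {T of PreTopologicalMonoid T & PreTopologicalMonoid_isTopologicalMonoid T}.

Record semiflow (T : topologicalMonoidType) (X : topologicalType) := Semiflow {
  flow :> T -> X -> X;
  flow_continuous : continuous (fun p : T * X => flow p.1 p.2);
  flow1 : forall x, flow 1 x = x;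
  flowM : forall t s x, flow t (flow s x) = flow (t * s) x
}.

Section Syndetic.
Variable T : topologicalMonoidType.
Implicit Types A K : set T.

Definition right_syndetic A := exists2 K, compact K &
  forall t, [set k * t | k in K] `&` A !=set0.

(* The compact subsets of a discrete space are the finite ones. *)
Definition discretely_right_syndetic A := exists2 K, finite_set K &
  forall t, [set k * t | k in K] `&` A !=set0.

Definition discretely_left_syndetic A := exists2 K, finite_set K &
  forall t, [set t * k | k in K] `&` A !=set0.

Definition bilaterally_discretely_syndetic A :=
  discretely_right_syndetic A /\ discretely_left_syndetic A.

End Syndetic.

Definition symmetric_entourage (X : uniformType) (alpha : set (X * X)) :=
  entourage alpha /\ alpha^-1 = alpha.

Section Homeomorphisms.
Variable X : topologicalType.

Definition homeomorphism (p : X -> X) := continuous p /\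
  exists q : X -> X, [/\ continuous q, cancel p q & cancel q p].

(* The neutral element of a group of bijections under composition is
   necessarily the identity map. *)
Definition group_of_homeomorphisms (G : set (X -> X)) :=
  [/\ forall p, G p -> homeomorphism p,
      G id,
      forall p q, G p -> G q -> G (p \o q) &
      forall p, G p -> exists q, [/\ G q, cancel p q & cancel q p]].

End Homeomorphisms.

Section SemiflowProperties.
Variables (T : topologicalMonoidType) (X : uniformType) (f : semiflow T X).

Definition surjective_flow := forall t, f t @` [set: X] = [set: X].

(* Uniform equicontinuity, unlike the library's pointwise [equicontinuous]. *)
Definition equicontinuous_flow :=
  forall eps : set (X * X), symmetric_entourage eps ->
  exists2 delta : set (X * X), symmetric_entourage delta &
    forall x y, delta (x, y) -> forall t, eps (f t x, f t y).

Definition ellis : set {ptws X -> X} :=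
  closure [set (f t : {ptws X -> X}) | t in [set: T]].

Definition moves_within (A : set T) (alpha : set (X * X)) :=
  forall x, [set f t x | t in A] `<=` xsection alpha x.

Definition almost_periodic :=
  forall eps : set (X * X), symmetric_entourage eps ->
  exists2 A : set T, right_syndetic A & moves_within A eps.

Definition discretely_almost_periodic :=
  forall eps : set (X * X), symmetric_entourage eps ->
  exists2 A : set T, discretely_right_syndetic A & moves_within A eps.

Definition bilaterally_discretely_almost_periodic :=
  forall alpha : set (X * X), symmetric_entourage alpha ->
  exists2 A : set T, bilaterally_discretely_syndetic A & moves_within A alpha.

(* [inv] is meant to be the inverse operation of a group structure on T. *)
Definition symmetrically_discretely_almost_periodic (inv : T -> T) :=
  forall alpha : set (X * X), symmetric_entourage alpha ->
  exists A : set T, [/\ A = inv @` A, discretely_right_syndetic A &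
    moves_within A alpha].

End SemiflowProperties.

(* Main.v *)
(* If every t in T satisfies "k t is uniformly close to the identity" for some k
   in a fixed finite set, the pigeonhole principle applied to the powers t^n
   gives s = t^j, commuting with t, with s t uniformly close to the identity.
   Hence tX is dense, so tX = X, and t ~ k s t ~ k: up to uniform closeness T is
   finite, which gives equicontinuity.  Conversely equicontinuity makes T
   uniformly totally bounded (its pointwise closure E(T,X) is compact), and with
   surjectivity the same pigeonhole argument produces s = t^j again; it is an
   approximate inverse of t on both sides, which yields both the bilateral
   syndeticity and the group property of the uniform closure E(T,X).
   That a pointwise compact group of homeomorphisms is equicontinuous follows by
   translation from equicontinuity on a nonempty open subset, obtained by a
   double limit argument in the style of Namioka's theorem. *)

Require Import Defs.
From mathcomp Require Import all_boot.
From mathcomp Require Import all_classical.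
From mathcomp Require Import topology.

Set Implicit Arguments.
Unset Strict Implicit.
Unset Printing Implicit Defensive.

Local Open Scope classical_set_scope.

(** * Pigeonhole principle and compactness arguments *)

(** The gap [j.+1] is positive, so that among powers of [t] it splits into [t ^+ j] and one further
    factor [t]. *)
Lemma eq_dist_of_finite_range (S : Type) (K : set S) (u : nat -> S) :
  finite_set K -> (forall n, K (u n)) -> exists n j, u n = u (n + j.+1)%N.
Proof.
move=> /finite_setPn finK Ku; apply: contrapT => ndist; apply: finK.
suff uinj : injective u.
  have uK : u @^-1` K = [set: nat] by apply/seteqP; split=> // n _; exact: Ku.
  by rewrite -uK; apply: card_ge_preimage => ? ? _ _; exact: uinj.
have ltN m n : (m < n)%N -> u m <> u n.
  move=> mn umn; apply: ndist; exists m, (n - m).-1.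
  by rewrite prednK ?subn_gt0// subnKC// ltnW.
by move=> m n umn; have [/ltN|/ltN/nesym|] := ltngtP m n.
Qed.

(** Directedness makes the sets [up a] a filter base; compactness in its near-covering form then
    patches the local choices of [a] into a single one. *)
Lemma compact_directed (S : topologicalType) (K : set S) (A : Type) (B : set A)
    (Q : A -> S -> Prop) :
  compact K -> B !=set0 ->
  (forall a b, B a -> B b ->
    exists2 c, B c & forall k, Q a k \/ Q b k -> Q c k) ->
  (forall k, K k -> exists2 a, B a & \forall k' \near k, K k' -> Q a k') ->
  exists2 a, B a & forall k, K k -> Q a k.
Proof.
move=> cK [a0 Ba0] dirB loc.
pose up a : set A := [set b | forall k, Q a k -> Q b k].
have FF : Filter (filter_from B up).
  apply: filter_from_filter; first by exists a0.
  move=> a b Ba Bb; have [c Bc abc] := dirB a b Ba Bb; exists c => // d cd.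
  by split=> k Qk; apply: cd; apply: abc; [left|right].
move/compact_near_coveringP/near_covering_withinP : cK.
move=> /(_ A (filter_from B up) Q FF) [|a Ba Ka].
  move=> k /loc[a Ba ka].
  exists ([set k' | K k' -> Q a k'], up a); first by split=> //; exists a.
  by move=> [k' b] [/= k'a ab] Kk'; apply: ab; exact: k'a.
by exists a => // k Kk; apply: (Ka a).
Qed.

(** The directed family consists of the finite subsets of [K]; near [k] the singleton [[set k]]
    serves. *)
Lemma compact_finite_net (S : topologicalType) (K : set S)
    (R : S -> S -> Prop) :
  compact K -> (forall k, K k -> \forall k' \near k, K k' -> R k k') ->
  exists2 F, finite_set F & F `<=` K /\
    forall k', K k' -> exists2 k, F k & R k k'.
Proof.
move=> cK locR.
have [||k Kk|F [finF FK] FR] := @compact_directed S K (set S)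
  [set F | finite_set F /\ F `<=` K] (fun F k' => exists2 k, F k & R k k') cK.
- by exists set0; split=> //; exact: finite_set0.
- move=> F G [finF FK] [finG GK]; exists (F `|` G).
    by split; [rewrite finite_setU | rewrite subUset].
  by move=> k [] [l ? ?]; exists l => //; [left|right].
- exists [set k]; first by split; [exact: finite_set1|move=> _ ->].
  by have := locR k Kk; apply: filterS => k' Rk' /Rk'; exists k.
- by exists F.
Qed.

(** * Entourages and the topology of pointwise convergence *)

Lemma hausdorff_eq (X : uniformType) (x y : X) :
  hausdorff_space X -> (forall E, entourage E -> E (x, y)) -> x = y.
Proof. by move=> hX xy; apply: close_eq => //; rewrite entourage_close. Qed.

Lemma symmetric_entourage_sub {X : uniformType} {E : set (X * X)} :
  entourage E -> exists2 D, symmetric_entourage D & D `<=` E.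
Proof.
move=> entE; exists (E `&` E^-1)%relation; last by move=> ? [].
split; first exact: entourage_invI.
by apply/seteqP; split=> -[x y] [].
Qed.

Lemma near_entourage2 {X : uniformType} (x : X) {E : set (X * X)} :
  entourage E -> \forall y \near x, E (x, y) /\ E (y, x).
Proof.
move=> entE; near=> y; split.
  by near: y; exact: (cvg_entourage cvg_id).
suff : (E^-1)%relation (x, y) by [].
by near: y; apply: (cvg_entourage cvg_id); exact: entourage_inv.
Unshelve. all: by end_near. Qed.

(** Near a point [(a, b)] of the closure, five [V]-steps lead from [a''] to [b''] through [a], [a'],
    [b'] and [b]; three halvings of [E] leave room for them. *)
Lemma entourage_closure_interior {X : uniformType} {E : set (X * X)} :
  entourage E -> exists2 V, entourage V & closure V `<=` E°.
Proof.
move=> entE; pose E1 := split_ent E; pose E2 := split_ent E1.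
pose V := split_ent E2.
have entE1 : entourage E1 by exact: entourage_split_ent.
have entE2 : entourage E2 by exact: entourage_split_ent.
have entV : entourage V by exact: entourage_split_ent.
exists V => // -[a b] clV.
have near_ab : nbhs (a, b) [set p | (V (a, p.1) /\ V (p.1, a)) /\
                                   (V (b, p.2) /\ V (p.2, b))].
  exists ([set a' | V (a, a') /\ V (a', a)], [set b' | V (b, b') /\ V (b', b)]).
    by split; exact: near_entourage2.
  by move=> [a' b'] [].
have [[a' b'] [Vab' /= [[Va Va'] [Vb Vb']]]] := clV _ near_ab.
apply: filterS near_ab => -[a'' b''] /= [[_ Va''] [Vb'' _]].
apply: (entourage_split a') => //.
  by apply: split_ent_subset => //; exact: (entourage_split a).
apply: (entourage_split b) => //; first exact: (entourage_split b').
exact: split_ent_subset.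
Qed.

Lemma cluster_closed {I : Type} {F : set_system I} {FF : Filter F}
    {S : topologicalType} {u : I -> S} {p : S} {C : set S} :
  cluster (u @ F) p -> closed C -> (\forall i \near F, C (u i)) -> C p.
Proof. by move=> up Ccl FC; apply: Ccl => B pB; exact: up. Qed.

Lemma eval_continuous {X : uniformType} (x : X) :
  continuous (fun q : {ptws X -> X} => q x).
Proof. exact: (@proj_continuous X (fun=> X) x). Qed.

Lemma near_eval2 {X : uniformType} (p : {ptws X -> X}) (x : X)
    {E : set (X * X)} :
  entourage E -> \forall q \near p, E (p x, q x) /\ E (q x, p x).
Proof.
by move=> entE; exact: (@eval_continuous X x p _ (near_entourage2 (p x) entE)).
Qed.

Lemma eval_pair_continuous {X : uniformType} (x y : X) :
  continuous (fun q : {ptws X -> X} => (q x, q y)).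
Proof.
move=> q.
exact: (cvg_pair (@eval_continuous X x q) (@eval_continuous X y q)).
Qed.

Lemma map_pair_continuous {X : topologicalType} (p : X -> X) :
  continuous p -> continuous (fun z : X * X => (p z.1, p z.2)).
Proof.
move=> pc z.
have pc1 : p \o fst @ z --> p z.1.
  by apply: (cvg_comp _ p); [exact: cvg_fst|exact: pc].
have pc2 : p \o snd @ z --> p z.2.
  by apply: (cvg_comp _ p); [exact: cvg_snd|exact: pc].
exact: (cvg_pair pc1 pc2).
Qed.

Lemma comp_ptws_continuous {X : uniformType} (h : X -> X) :
  continuous (fun q : {ptws X -> X} => (q \o h : {ptws X -> X})).
Proof.
move=> q.
have FF : Filter ((fun q : {ptws X -> X} => (q \o h : {ptws X -> X})) @ q).
  exact/fmap_filter/nbhs_filter.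
apply/cvg_sup => x U [V] [[W] oW <-] Wqx WU.
apply: (filterS WU); apply: (@eval_continuous X (h x) q).
exact: open_nbhs_nbhs.
Qed.

(** * Uniform moduli from compactness *)

Lemma equicontinuous_of_local (X : uniformType) (S : topologicalType)
    (K : set S) (phi : S -> X -> X) (E : set (X * X)) : compact K ->
  (forall k, K k -> exists2 D, entourage D &
    \forall k' \near k, K k' ->
      forall x y, D (x, y) -> E (phi k' x, phi k' y)) ->
  exists2 D, entourage D &
    forall k, K k -> forall x y, D (x, y) -> E (phi k x, phi k y).
Proof.
move=> cK loc; apply: (@compact_directed _ _ _ entourage
  (fun D k => forall x y, D (x, y) -> E (phi k x, phi k y))) => //.
- by exists setT; exact: entourageT.
- move=> D1 D2 entD1 entD2; exists (D1 `&` D2); first exact: filterI.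
  by move=> k [] DE x y [? ?]; exact: DE.
Qed.

(** This is the Heine-Cantor theorem, with the entourages directed by intersection. *)
Lemma compact_unif_continuous {X : uniformType} {p : X -> X} {E : set (X * X)} :
  compact [set: X] -> continuous p -> entourage E ->
  exists2 D, entourage D & forall x y, D (x, y) -> E (p x, p y).
Proof.
move=> cX pc entE.
have [||z _|D entD DE] := @compact_directed _ _ _ entourage
  (fun D x => forall y, D (x, y) -> E (p x, p y)) cX.
- by exists setT; exact: entourageT.
- move=> D1 D2 entD1 entD2; exists (D1 `&` D2); first exact: filterI.
  by move=> k [] DE y [? ?]; exact: DE.
- have entE' : entourage (split_ent E) by exact: entourage_split_ent.
  have := pc z _ (near_entourage2 (p z) entE').
  move=> /nbhsP[D entD zD].
  exists (split_ent D) => //.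
  have := near_entourage2 z (entourage_split_ent entD).
  apply: filterS => x [Dzx _] _ y Dxy.
  apply: (entourage_split (p z)) => //.
    suff [] : split_ent E (p z, p x) /\ split_ent E (p x, p z) by [].
    by apply: zD; apply/xsectionP; exact: split_ent_subset.
  suff [] : split_ent E (p z, p y) /\ split_ent E (p y, p z) by [].
  by apply: zD; apply/xsectionP; exact: (entourage_split x).
- by exists D => // x y; exact: DE.
Qed.

(** * Uniform estimates for a semiflow on a compact space *)

Section CompactSemiflow.
Variables (T : topologicalMonoidType) (X : uniformType) (f : semiflow T X).
Hypothesis compactX : compact [set: X].
Hypothesis hausdorffX : hausdorff_space X.

Local Open Scope group_scope.

Lemma flow_map_continuous t : continuous (f t).
Proof.
move=> x; have := @flow_continuous T X f (t, x).
move/(cvg_comp (fun y => (t, y)) _); apply.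
by apply: cvg_pair; [exact: cvg_cst|exact: cvg_id].
Qed.

(** A tube lemma: joint continuity gives the estimate near each [(t, x)], and compactness of [X]
    makes the neighbourhood of [t] uniform in [x]. *)
Lemma near_flow_uniform t E : entourage E ->
  \forall t' \near t, forall x, E (f t x, f t' x).
Proof.
move=> entE; have entE' := entourage_split_ent entE.
have /compact_near_coveringP/(_ T (nbhs t) (fun t' x => E (f t x, f t' x))
  (nbhs_filter t)) H := compactX.
suff : \forall t' \near t, [set: X] `<=` (fun x => E (f t x, f t' x)).
  by apply: filterS => t' tt' x; exact: tt'.
apply: H => x _.
have [[A B] [/= nA nB] AB] :=
  @flow_continuous T X f (t, x) _ (near_entourage2 (f t x) entE').
have nB' := @flow_map_continuous t x _ (near_entourage2 (f t x) entE').
exists (B `&` (f t @^-1` [set y | split_ent E (f t x, y) /\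
                               split_ent E (y, f t x)]), A).
  by split=> //; exact: filterI.
move=> [x' t'] [/= [Bx' [_ ?]] At'].
apply: (entourage_split (f t x)) => //.
by have /= [] := AB (t', x') (conj At' Bx').
Qed.

(** Each [f k] is uniformly continuous, and its modulus carries over to the uniformly close maps
    [f k']. *)
Lemma compact_flow_equicontinuous K E : compact K -> entourage E ->
  exists2 D, entourage D &
    forall k, K k -> forall x y, D (x, y) -> E (f k x, f k y).
Proof.
move=> cK entE; apply: equicontinuous_of_local => // k _.
have entE' := entourage_split_ent (entourage_split_ent entE).
have [D entD DE] :=
  compact_unif_continuous compactX (@flow_map_continuous k) entE'.
exists D => //; have entE'' := entourage_invI entE'.
have := @near_flow_uniform k _ entE''; apply: filterS => k' kk' _ x y /DE kxy.
have [_ ?] := kk' x; have [? _] := kk' y.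
apply: (entourage_split (f k y)); first by exact: entE.
  by apply: (entourage_split (f k x)) => //; exact: entourage_split_ent.
by apply: split_ent_subset => //; exact: entourage_split_ent.
Qed.

(** Since [s] commutes with [t], [f s] approximately inverts [f t] on both sides. *)
Definition returns_uniformly := forall E, entourage E ->
  forall t, exists2 s, t * s = s * t & forall x, E (x, f (s * t) x).

(** Total boundedness of the maps [f t] in the uniformity of uniform convergence. *)
Definition totally_bounded_flow := forall E, entourage E ->
  exists2 F : set T, finite_set F &
    forall t, exists2 k, F k & forall x, E (f t x, f k x).

(** * From almost periodicity to equicontinuity and surjectivity *)

(** A finite net of [K] for uniform closeness replaces [K], at the cost of enlarging [A] to all
    elements that move every point within [eps]. *)
Lemma almost_periodic_discretely :
  almost_periodic f -> discretely_almost_periodic f.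
Proof.
move=> ap eps [enteps symeps].
have [E [entE symE] Esub] :=
  symmetric_entourage_sub (entourage_split_ent enteps).
have [A [K cK KA] AE] := ap E (conj entE symE).
have [|F finF [_ FK]] := compact_finite_net
  (R := fun k k' => forall x, E (f k' x, f k x)) cK.
  move=> k _; have := @near_flow_uniform k _ entE; apply: filterS => k' kk' _ x.
  by rewrite -symE; exact: kk'.
exists [set t | forall x, eps (x, f t x)]; last first.
  by move=> x _ [t tE <-]; apply/xsectionP; exact: tE.
exists F => // t; have [_ [[k Kk <-] Akt]] := KA t.
have [k' Fk' kk'] := FK k Kk; exists (k' * t); split; first by exists k'.
move=> x /=; apply: (entourage_split (f (k * t) x)) => //.
  by apply: Esub; apply/xsectionP; apply: AE; exists (k * t).
by apply: Esub; rewrite -!flowM; exact: kk'.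
Qed.

Lemma discretely_ap_entourage :
  discretely_almost_periodic f -> forall E, entourage E ->
  exists2 K : set T, finite_set K &
    forall t, exists2 k, K k & forall x, E (x, f (k * t) x).
Proof.
move=> dap E entE; have [D symD DE] := symmetric_entourage_sub entE.
have [A [K finK KA] AD] := dap D symD; exists K => // t.
have [_ [[k Kk <-] Akt]] := KA t; exists k => // x.
by apply: DE; apply/xsectionP; apply: AD; exists (k * t).
Qed.

Lemma discretely_ap_returns : discretely_almost_periodic f -> returns_uniformly.
Proof.
move=> dap E entE t; have entE' := entourage_split_ent entE.
have [K finK tK] := discretely_ap_entourage dap (entourage_invI entE').
have /choice[u uP] : forall n : nat, exists k, K k /\ forall x,
    (split_ent E `&` (split_ent E)^-1)%relation (x, f (k * t ^+ n) x).
  by move=> n; have [k Kk kn] := tK (t ^+ n); exists k.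
have [n [j unj]] := eq_dist_of_finite_range finK (fun n => (uP n).1).
exists (t ^+ j); first by rewrite -expgS expgSr.
(* For the common value [k] of [u], the point [k t^(n+j+1) x] is close to [x]; being the image of
   [t^(j+1) x] under [k t^n], it is also close to [t^(j+1) x]. *)
move=> x; apply: (entourage_split (f (u n * t ^+ (n + j.+1)) x)) => //.
  by rewrite unj; have [] := (uP (n + j.+1)%N).2 x.
rewrite expgnDr mulgA expgSr.
by have [_] := (uP n).2 (f (t ^+ j * t) x); rewrite flowM.
Qed.

Lemma discretely_ap_totally_bounded :
  discretely_almost_periodic f -> totally_bounded_flow.
Proof.
move=> dap E entE; have entE' := entourage_split_ent entE.
have [K finK tK] := discretely_ap_entourage dap entE'.
have [D entD KD] := compact_flow_equicontinuous (finite_compact finK) entE'.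
exists K => // t.
(* The return of [s t] is measured by [D] because some [k] in [K] is applied to it afterwards. *)
have [s ts st] := discretely_ap_returns dap (entourage_inv entD) t.
have [k Kk ks] := tK s; exists k => // x.
apply: (entourage_split (f (k * s) (f t x))) => //.
by rewrite flowM -mulgA -flowM; apply: KD => //; exact: st.
Qed.

(** A finite net has a common modulus, and every [f t] is uniformly close to a member of the net. *)
Lemma totally_bounded_equicontinuous :
  totally_bounded_flow -> equicontinuous_flow f.
Proof.
move=> tbf eps [enteps symeps]; have entE := entourage_split_ent enteps.
have entE' := entourage_invI (entourage_split_ent entE).
have [F finF tF] := tbf _ entE'.
have [D entD FD] := compact_flow_equicontinuous (finite_compact finF)
  (entourage_split_ent entE).
have [D' symD' D'D] := symmetric_entourage_sub entD.
exists D' => // x y /D'D Dxy t; have [k Fk tk] := tF t.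
have [tkx _] := tk x; have [_ kty] := tk y.
apply: (entourage_split (f k y)) => //; last exact: split_ent_subset.
by apply: (entourage_split (f k x)) => //; exact: FD.
Qed.

(** The range is compact, hence closed, and the second hypothesis makes it dense. *)
Lemma surjective_of_dense_range (p : X -> X) : continuous p ->
  (forall E, entourage E -> forall y, exists x, E (y, p x)) ->
  p @` [set: X] = [set: X].
Proof.
move=> pc pE; apply/seteqP; split=> // y _.
have : compact (p @` [set: X]).
  by apply: continuous_compact => //; exact: continuous_subspaceT.
move=> /(compact_closed hausdorffX); apply => B /nbhsP[E entE EB].
have [x yx] := pE E entE y; exists (p x); split; first by exists x.
by apply: EB; apply/xsectionP.
Qed.

Lemma returns_surjective : returns_uniformly -> surjective_flow f.
Proof.
move=> ret t; apply: surjective_of_dense_range => [|E entE y].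
  exact: flow_map_continuous.
have [s ts st] := ret E entE t; exists (f s y).
by rewrite flowM ts; exact: st.
Qed.

(** * The Ellis semigroup of an equicontinuous semiflow *)

Lemma equicontinuous_entourage : equicontinuous_flow f ->
  forall E, entourage E -> exists2 D, entourage D &
    forall x y, D (x, y) -> forall t, E (f t x, f t y).
Proof.
move=> eqf E entE; have [E' symE' E'E] := symmetric_entourage_sub entE.
have [D [entD _] DE'] := eqf E' symE'; exists D => // x y Dxy t.
by apply: E'E; exact: DE'.
Qed.

Lemma equicontinuous_of_entourage :
  (forall E, entourage E -> exists2 D, entourage D &
    forall x y, D (x, y) -> forall t, E (f t x, f t y)) ->
  equicontinuous_flow f.
Proof.
move=> eqf eps [enteps _]; have [D entD DE] := eqf eps enteps.
have [D' symD' D'D] := symmetric_entourage_sub entD.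
by exists D' => // x y /D'D; exact: DE.
Qed.

Lemma flow_ellis t : ellis f (f t).
Proof. by apply: subset_closure; exists t. Qed.

Lemma compact_ellis : compact (ellis f).
Proof.
apply: (@subclosed_compact _ _
  [set p : {ptws X -> X} | forall x, [set: X] (p x)]) => //.
  exact: closed_closure.
by apply: (@tychonoff X (fun=> X) (fun=> [set: X])) => _.
Qed.

(** Only the two points [x] and [y] matter at a time, so approximating [p] there by some [f t]
    transfers the modulus of the flow. *)
Lemma ellis_equicontinuous : equicontinuous_flow f ->
  forall E, entourage E -> exists2 D, entourage D &
    forall p, ellis f p -> forall x y, D (x, y) -> E (p x, p y).
Proof.
move=> eqf E entE; have entE' := entourage_split_ent entE.
have entE'' := entourage_split_ent entE'.
have [D entD DE] := equicontinuous_entourage eqf entE''.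
exists D => // p pE x y Dxy.
have [_ [[t _ <-] /= [[ptx _] [_ tpy]]]] := pE _ 
  (@filterI _ _ (nbhs_filter (p : {ptws X -> X})) _ _
    (near_eval2 p x entE'') (near_eval2 p y entE'')).
apply: (entourage_split (f t y)) => //; last exact: split_ent_subset.
by apply: (entourage_split (f t x)) => //; exact: DE.
Qed.

Lemma ellis_continuous : equicontinuous_flow f ->
  forall p, ellis f p -> continuous p.
Proof.
move=> eqf p pE x B /nbhsP[E entE EB].
have [D entD DE] := ellis_equicontinuous eqf entE.
apply: filterS (nbhs_entourage x entD) => y /xsectionP Dxy.
by apply: EB; apply/xsectionP; exact: DE.
Qed.

(** On an equicontinuous set of maps of a compact space, pointwise closeness is uniform
    closeness. *)
Lemma near_ellis_uniform p E : equicontinuous_flow f -> ellis f p ->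
  entourage E ->
  \forall q \near (p : {ptws X -> X}), ellis f q -> forall x, E (p x, q x).
Proof.
move=> eqf pE entE; have entE' := entourage_split_ent entE.
have entE'' := entourage_split_ent entE'.
have /compact_near_coveringP/(_ _ (nbhs (p : {ptws X -> X}))
  (fun q x => ellis f q -> E (p x, q x)) (nbhs_filter _)) H := compactX.
suff : \forall q \near (p : {ptws X -> X}),
    [set: X] `<=` (fun x => ellis f q -> E (p x, q x)).
  by apply: filterS => q pq qE x; exact: pq.
apply: H => x _; have [D entD DE] := ellis_equicontinuous eqf entE''.
exists ([set x' | D (x, x') /\ D (x', x)],
    [set q : {ptws X -> X} | split_ent (split_ent E) (p x, q x) /\
                             split_ent (split_ent E) (q x, p x)]).
  by split; [exact: near_entourage2|exact: near_eval2].
move=> [x' q] [/= [xx' x'x] [pqx _]] qE.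
apply: (entourage_split (q x)) => //; last first.
  by apply: split_ent_subset => //; exact: DE.
by apply: (entourage_split (p x)) => //; exact: DE.
Qed.

Lemma ellis_uniform_approx p E : equicontinuous_flow f -> ellis f p ->
  entourage E -> exists t, forall x, E (p x, f t x).
Proof.
move=> eqf pE entE.
have [_ [[t _ <-] pt]] := pE _ (near_ellis_uniform eqf pE entE).
by exists t; apply: pt; exact: flow_ellis.
Qed.

Lemma ellis_of_uniform_approx p :
  (forall E, entourage E -> exists t, forall x, E (p x, f t x)) -> ellis f p.
Proof.
move=> papprox B.
pose F := filter_from entourage
  (fun E => [set q : X -> X | forall x, E (p x, q x)]).
have FF : Filter F.
  apply: filter_from_filter; first by exists setT; exact: entourageT.
  move=> D E entD entE; exists (D `&` E); first exact: filterI.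
  by move=> q DEq; split=> x; have [] := DEq x.
have Fp : {ptws, F --> p}.
  apply/pointwise_cvgP => // x A /nbhsP[E entE EA].
  by exists E => // q pq; apply: EA; apply/xsectionP; exact: pq.
move=> /Fp[E entE EB]; have [t pt] := papprox E entE.
by exists (f t); split; [exists t|exact: EB].
Qed.

(** * Return times, bilateral syndeticity and inverses from equicontinuity *)

Lemma equicontinuous_totally_bounded :
  equicontinuous_flow f -> totally_bounded_flow.
Proof.
move=> eqf E entE; pose D := (split_ent E `&` (split_ent E)^-1)%relation.
have entD : entourage D by exact/entourage_invI/entourage_split_ent.
have [|F finF [FE FR]] := compact_finite_net
  (R := fun p q : {ptws X -> X} => forall x, D (p x, q x)) compact_ellis.
  by move=> p pE; exact: near_ellis_uniform.
(* The centres of the net lie in the Ellis semigroup and are moved to nearby elements of [T];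
   elsewhere [1] is a dummy value. *)
have /choice[c cP] : forall p : X -> X, exists t, ellis f p ->
    forall x, D (p x, f t x).
  move=> p; have [pE|npE] := pselect (ellis f p); last by exists 1 => /npE.
  by have [t pt] := ellis_uniform_approx eqf pE entD; exists t.
exists (c @` F); first exact: finite_image.
move=> t; have [p Fp pt] := FR _ (@flow_ellis t).
exists (c p); first by exists p.
move=> x; apply: (entourage_split (p x)) => //; first by have [_] := pt x.
by have [] := cP p (FE p Fp) x.
Qed.

Lemma equicontinuous_returns :
  equicontinuous_flow f -> surjective_flow f -> returns_uniformly.
Proof.
move=> eqf surj E entE t.
have entE' := entourage_invI (entourage_split_ent entE).
have [F finF tF] := equicontinuous_totally_bounded eqf entE'.
have /choice[u uP] : forall n : nat, exists k, F k /\ forall x,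
    (split_ent E `&` (split_ent E)^-1)%relation (f (t ^+ n) x, f k x).
  by move=> n; have [k Fk nk] := tF (t ^+ n); exists k.
have [n [j unj]] := eq_dist_of_finite_range finF (fun n => (uP n).1).
exists (t ^+ j); first by rewrite -expgS expgSr.
(* Surjectivity writes [y] as [t^n x], which is close to [t^(n+j+1) x], that is, to [t^(j+1) y]. *)
move=> y; have [x _ <-] : (f (t ^+ n) @` [set: X]) y by rewrite surj.
apply: (entourage_split (f (u n) x)) => //; first by have [] := (uP n).2 x.
rewrite flowM -expgSr -expgnDr unj addnC.
by have [_] := (uP (n + j.+1)%N).2 x; rewrite addnC.
Qed.

Lemma equicontinuous_bilaterally : equicontinuous_flow f -> surjective_flow f ->
  bilaterally_discretely_almost_periodic f.
Proof.
move=> eqf surj eps [enteps _]; have entE := entourage_split_ent enteps.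
have ret := equicontinuous_returns eqf surj entE.
have [D entD DE] := equicontinuous_entourage eqf entE.
(* The product [k t] only needs [k] close to [s] at the point [t x]; for [t k] the closeness must
   survive [t], hence the intersection with [D]. *)
have [F finF tF] := equicontinuous_totally_bounded eqf (filterI entD entE).
exists [set t | forall x, eps (x, f t x)]; last first.
  by move=> x _ [t tE <-]; apply/xsectionP; exact: tE.
split; exists F => // t; have [s ts st] := ret t; have [k Fk sk] := tF s.
- exists (k * t); split; first by exists k.
  move=> x; apply: (entourage_split (f (s * t) x)) => //.
  by rewrite -!flowM; have [] := sk (f t x).
- exists (t * k); split; first by exists k.
  move=> x; apply: (entourage_split (f (s * t) x)) => //.
  by rewrite -ts -!flowM; apply: DE; have [] := sk x.
Qed.

Lemma equicontinuous_ellis_group : equicontinuous_flow f -> surjective_flow f ->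
  group_of_homeomorphisms (ellis f).
Proof.
move=> eqf surj.
have pc := ellis_continuous eqf.
(* A return time [s] of some [t] approximating [p] approximately inverts [p] on both sides. *)
have inv_approx p E : ellis f p -> entourage E -> exists s,
    (forall x, E (x, f s (p x))) /\ (forall x, E (x, p (f s x))).
  move=> pE entE; have entE' := entourage_split_ent entE.
  have [D entD DE] := equicontinuous_entourage eqf entE'.
  have [t pt] :=
    ellis_uniform_approx eqf pE (entourage_inv (filterI entD entE')).
  have [s ts st] := equicontinuous_returns eqf surj entE' t.
  exists s; split=> x; apply: (entourage_split (f (s * t) x)) => //.
    by rewrite -flowM; apply: DE; have [] := pt x.
  by rewrite -ts -flowM; have [] := pt (f s x).
have inv_ellis p : ellis f p ->
    exists q, [/\ ellis f q, cancel p q & cancel q p].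
  move=> pE.
  have psurj : p @` [set: X] = [set: X].
    apply: surjective_of_dense_range => [|E entE y]; first exact: pc.
    by have [s [_ sE]] := inv_approx p E pE entE; exists (f s y).
  (* If [p x = p y], applying an approximate inverse shows [x] and [y] arbitrarily close. *)
  have pinj : injective p.
    move=> x y pxy; apply: hausdorff_eq => // E entE.
    have [s [sE _]] :=
      inv_approx p _ pE (entourage_invI (entourage_split_ent entE)).
    apply: (entourage_split (f s (p x))) => //; first by have [] := sE x.
    by rewrite pxy; have [] := sE y.
  have /choice[q qP] : forall y, exists x, p x = y.
    by move=> y; have [x _ <-] : (p @` [set: X]) y; [rewrite psurj|exists x].
  exists q; split=> //; last by move=> x; apply: pinj; rewrite qP.
  (* As [y = p (q y)], the approximate inverses [f s] of [p] approximate [q] uniformly. *)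
  apply: ellis_of_uniform_approx => E entE.
  have [s [sE _]] := inv_approx p E pE entE.
  by exists s => y; rewrite -{2}(qP y).
split=> //.
- move=> p pE; split; first exact: pc.
  by have [q [qE pq qp]] := inv_ellis p pE; exists q; split=> //; exact: pc.
- have <- : f 1 = id :> (X -> X) by apply/funext => x; exact: flow1.
  exact: flow_ellis.
- move=> p q pE qE; apply: ellis_of_uniform_approx => E entE.
  have entE' := entourage_split_ent entE.
  have [D entD DE] := equicontinuous_entourage eqf entE'.
  have [t pt] := ellis_uniform_approx eqf pE entE'.
  have [s qs] := ellis_uniform_approx eqf qE entD.
  exists (t * s) => x; apply: (entourage_split (f t (q x))) => //.
    exact: pt.
  by rewrite -flowM; exact: DE.
Qed.

(** * Symmetric return sets when the phase semigroup is a group *)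

(** The set of all [t] moving every point within [eps] is itself symmetric: evaluate at [inv t]
    applied to [x] and use the symmetry of [eps]. *)
Lemma discretely_ap_symmetrically (inv : T -> T) :
  left_inverse 1 inv mul -> right_inverse 1 inv mul ->
  discretely_almost_periodic f ->
  symmetrically_discretely_almost_periodic f inv.
Proof.
move=> mulVt multV dap eps [enteps symeps].
have invK t : inv (inv t) = t.
  by rewrite -[inv (inv t)]mulg1 -(mulVt t) mulgA mulVt mul1g.
have invE t : (forall x, eps (x, f t x)) -> forall x, eps (x, f (inv t) x).
  move=> tE x; rewrite -symeps /=.
  by have := tE (f (inv t) x); rewrite flowM multV flow1.
exists [set t | forall x, eps (x, f t x)]; split.
- apply/seteqP; split=> t.
    by move=> tE; exists (inv t) => //; exact: invE.
  by move=> [s sE <-]; exact: invE.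
- have [K finK tK] := discretely_ap_entourage dap enteps; exists K => // t.
  by have [k Kk kt] := tK t; exists (k * t); split => //; exists k.
- by move=> x _ [t tE <-]; apply/xsectionP; exact: tE.
Qed.

End CompactSemiflow.

(** * Equicontinuity of compact groups of homeomorphisms *)

Lemma locally_equicontinuous (X : uniformType) (G : set {ptws X -> X})
    (E : set (X * X)) :
  compact [set: X] -> compact G -> G !=set0 ->
  (forall p, G p -> continuous (p : X -> X)) -> entourage E ->
  exists2 U : set {ptws X -> X}, open U /\ G `&` U !=set0 &
    exists2 D, entourage D &
      forall p, G p -> U p -> forall x y, D (x, y) -> E (p x, p y).
Proof.
move=> cX cG G0 Gc entE; apply: contrapT => noU.
have [W entW clWE] := entourage_closure_interior entE.
have [V entV clVW] := entourage_closure_interior entW.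
(* States (D, U) of the construction of g_n in U and z_n = (x_n, y_n) in D with
   (g_n x_n, g_n y_n) outside E: shrinking D keeps the g_n-images of all later
   z_m within V, shrinking U keeps the images of z_n under all later g_m
   outside W.  At cluster points p of (g_n) and w of (z_n) the two clash. *)
pose state := {s : set (X * X) * set {ptws X -> X} |
  [/\ entourage s.1, open s.2 & G `&` s.2 !=set0]}.
have step (s : state) : exists t : {ptws X -> X} * (X * X) * state,
    [/\ (G `&` (sval s).2) t.1.1, (sval s).1 t.1.2,
      (sval t.2).1 `<=` (sval s).1 `&`
        [set z | closure V (t.1.1 z.1, t.1.1 z.2)] &
      (sval t.2).2 `<=` (sval s).2 `&`
        [set p | ~ closure W (p t.1.2.1, p t.1.2.2)]].
  case: s => -[D U] [/= entD oU GU].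
  have [g [x [y [Gg Ug Dxy Egxy]]]] : exists g x y,
      [/\ G g, U g, D (x, y) & ~ E (g x, g y)].
    apply: contrapT => nogxy; apply: noU; exists U => //; exists D => //.
    move=> p Gp Up x y Dxy; apply: contrapT => nE; apply: nogxy.
    by exists p, x, y.
  have [D' entD' D'V] := compact_unif_continuous cX (Gc g Gg) entV.
  (* [U'] still meets [G], at [g] itself, because [closure W] lies inside [E]. *)
  pose U' := U `&` [set p : {ptws X -> X} | ~ closure W (p x, p y)].
  have oU' : open U'.
    apply: openI => //.
    rewrite -/(~` [set p : {ptws X -> X} | closure W (p x, p y)]).
    apply: closed_openC.
    have /continuous_closedP := @eval_pair_continuous X x y; apply.
    exact: closed_closure.
  have s'P : [/\ entourage (D `&` D'), open U' & G `&` U' !=set0].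
    split=> //; first exact: filterI.
    exists g; split=> //; split=> // clW; apply: Egxy.
    by apply: interior_subset; exact: clWE.
  exists (g, (x, y), exist _ (D `&` D', U') s'P); split=> //=.
  by move=> [a b] [Dab D'ab]; split=> //; apply: subset_closure; exact: D'V.
have [next nextP] := choice step.
have s0P : [/\ entourage [set: X * X], open [set: {ptws X -> X}] &
    G `&` [set: {ptws X -> X}] !=set0].
  by split; [exact: entourageT|exact: openT|rewrite setIT].
pose s n : state := iter n (fun s => (next s).2) (exist _ (_, _) s0P).
pose g n := (next (s n)).1.1; pose z n := (next (s n)).1.2.
have sD n m : (sval (s (m + n)%N)).1 `<=` (sval (s n)).1.
  elim: m => // m IH; apply: subset_trans IH.
  by have [_ _ sub _] := nextP (s (m + n)%N) => w /sub[].
have sU n m : (sval (s (m + n)%N)).2 `<=` (sval (s n)).2.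
  elim: m => // m IH; apply: subset_trans IH.
  by have [_ _ _ sub] := nextP (s (m + n)%N) => w /sub[].
have gV n m : (n < m)%N -> closure V (g n (z m).1, g n (z m).2).
  move=> nm; have [_ zm _ _] := nextP (s m); have [_ _ sub _] := nextP (s n).
  by apply: (sub (z m) _).2; apply: (@sD n.+1 (m - n.+1)%N); rewrite subnK.
(* Weakened to the interior of [W], the exclusion becomes a closed condition and passes to cluster
   points. *)
have gW n m : (n < m)%N -> ~ W° (g m (z n).1, g m (z n).2).
  move=> nm; have [[_ gm] _ _ _] := nextP (s m).
  have [_ _ _ sub] := nextP (s n).
  have : ~ closure W (g m (z n).1, g m (z n).2).
    by apply: (sub (g m) _).2; apply: (@sU n.+1 (m - n.+1)%N); rewrite subnK.
  by apply: contra_not => /interior_subset; exact: subset_closure.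
have gG n : G (g n) by have [[]] := nextP (s n).
have [p [Gp gp]] : G `&` cluster (g @ \oo) !=set0.
  by apply: cG; exists 0%N => // n _; exact: gG.
have cXX : compact [set: X * X] by rewrite -setXTT; exact: compact_setX.
have [w [_ zw]] : setT `&` cluster (z @ \oo) !=set0.
  by apply: cXX; exact: filterT.
have clCV : closed (closure V) by exact: closed_closure.
have clCW : closed (~` W°) by apply: open_closedC; exact: open_interior.
(* First order of limits: [z m] clusters at [w] under the fixed continuous [g n], then [g n]
   clusters at [p]. *)
have gwV n : closure V (g n w.1, g n w.2).
  have /continuous_closedP/(_ _ clCV) clC := map_pair_continuous (Gc _ (gG n)).
  by apply: (cluster_closed zw clC); exists n.+1 => // m; exact: gV.
have pwV : closure V (p w.1, p w.2).
  have /continuous_closedP/(_ _ clCV) clC := @eval_pair_continuous X w.1 w.2.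
  by apply: (cluster_closed gp clC); exact: nearW.
(* Opposite order: [g m] clusters at [p] on the fixed pair [z n], then [z n] clusters at [w] under
   the continuous [p]. *)
have pzW n : ~ W° (p (z n).1, p (z n).2).
  have /continuous_closedP/(_ _ clCW) clC :=
    @eval_pair_continuous X (z n).1 (z n).2.
  by apply: (cluster_closed gp clC); exists n.+1 => // m; exact: gW.
suff : ~ W° (p w.1, p w.2) by apply; exact: clVW.
have /continuous_closedP/(_ _ clCW) clC := map_pair_continuous (Gc _ Gp).
by apply: (cluster_closed zw clC); exact: nearW.
Qed.

(** Right translation by [h = q \o u], with [q] inverse to [k], takes [k] to [u], so [k' \o h] lies
    in [U] for [k'] near [k]. Then [k'] is [k' \o h] after the uniformly continuous inverse [w] of
    [h], and compactness of [G] patches these local moduli. *)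
Lemma compact_group_equicontinuous (X : uniformType) (G : set {ptws X -> X})
    (E : set (X * X)) :
  compact [set: X] -> compact G -> group_of_homeomorphisms G -> entourage E ->
  exists2 D, entourage D &
    forall p, G p -> forall x y, D (x, y) -> E (p x, p y).
Proof.
move=> cX cG [Ghom G1 GM GV] entE.
have Gc p : G p -> continuous (p : X -> X) by case/Ghom.
have [U [oU [u [Gu Uu]]] [D entD UD]] :=
  locally_equicontinuous cX cG (ex_intro _ _ G1) Gc entE.
apply: (@equicontinuous_of_local X _ G (fun p => p) E cG) => k Gk.
have [q [Gq kq qk]] := GV k Gk; have Gh : G (q \o u) by exact: GM.
have [w [Gw hw wh]] := GV _ Gh.
have [D' entD' D'D] := compact_unif_continuous cX (Gc w Gw) entD.
exists D' => //.
have kh : k \o (q \o u) = u by apply/funext => x /=; rewrite qk.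
have near_U : \forall k' \near k, U (k' \o (q \o u)).
  apply: (@comp_ptws_continuous X (q \o u) k U); apply: open_nbhs_nbhs.
  by rewrite kh.
apply: filterS near_U => k' Uk' Gk' x y /D'D /(UD _ (GM _ _ Gk' Gh) Uk').
by have /= -> := wh x; have /= -> := wh y.
Qed.

(** * The cycle of implications *)

Theorem theorem8p3 (T : topologicalMonoidType) (X : uniformType)
    (f : semiflow T X) (hausdorffT : hausdorff_space T)
    (X0 : [set: X] !=set0) (compactX : compact [set: X])
    (hausdorffX : hausdorff_space X) :
  [<-> almost_periodic f;
       equicontinuous_flow f /\ surjective_flow f;
       group_of_homeomorphisms (ellis f);
       bilaterally_discretely_almost_periodic f;
       discretely_almost_periodic f]
  /\
  (forall inv : T -> T,
     left_inverse 1%g inv mul -> right_inverse 1%g inv mul ->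
     [<-> almost_periodic f;
          equicontinuous_flow f /\ surjective_flow f;
          group_of_homeomorphisms (ellis f);
          bilaterally_discretely_almost_periodic f;
          discretely_almost_periodic f;
          symmetrically_discretely_almost_periodic f inv]).
Proof.
have h12 : almost_periodic f -> equicontinuous_flow f /\ surjective_flow f.
  move=> /(almost_periodic_discretely compactX) dap; split.
    apply: totally_bounded_equicontinuous => //.
    exact: discretely_ap_totally_bounded.
  by apply: returns_surjective => //; exact: discretely_ap_returns.
have h23 : equicontinuous_flow f /\ surjective_flow f ->
    group_of_homeomorphisms (ellis f).
  by case; exact: equicontinuous_ellis_group.
have h34 : group_of_homeomorphisms (ellis f) ->
    bilaterally_discretely_almost_periodic f.
  move=> grpE; apply: equicontinuous_bilaterally => //.
    apply: equicontinuous_of_entourage => E entE.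
    have [D entD DE] :=
      compact_group_equicontinuous compactX (compact_ellis compactX) grpE entE.
    by exists D => // x y Dxy t; apply: DE => //; exact: flow_ellis.
  have [homE _ _ _] := grpE.
  move=> t; have [_ [q [_ _ qK]]] := homE _ (@flow_ellis _ _ f t).
  by apply/seteqP; split=> // y _; exists (q y).
have h45 : bilaterally_discretely_almost_periodic f ->
    discretely_almost_periodic f.
  by move=> bap eps /bap[A [? _] ?]; exists A.
have h51 : discretely_almost_periodic f -> almost_periodic f.
  move=> dap eps /dap[A [K finK KA] ?]; exists A => //.
  by exists K => //; exact: finite_compact.
split=> [|inv mulVt multV]; first by tfae.
tfae => //; first exact: discretely_ap_symmetrically.
by move=> sap; apply: h51 => eps /sap[A [_ ? ?]]; exists A.
Qed.
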